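(* Consider a Bayesian persuasion problem $(\Omega, A, u_S, u_R, \mu)$ and a signaling scheme $\pi : \Omega \to \Delta^S$ with signal set $S$. Let $d(\pi)=\min_{s\in S} d(y^\pi_s)$. If $\mathsf{Range}(u_S) \subset [0,1]$, then for every round $k\ge 1$, $$BPR(\pi) - IR_k(\pi) \;\leq\; \frac{1}{d(\pi)}\,\sqrt{|S|}\,\sqrt{H(\omega|s)} ,$$ where $H(\omega|s)$ is the conditional entropy of the state given the signal under the joint law $p^\pi$.
   Context: All sets $\Omega$ (states), $A$ (receiver actions), $S$ (signals) are finite; $\Delta^{X}$ is the set of probability distributions on $X$. $\mu\in\Delta^\Omega$ is the state distribution, $u_S,u_R:\Omega\times A\to\mathbb{R}$ are the sender and receiver utilities; $u_S(:,a),u_R(:,a)\in\mathbb{R}^\Omega$ are the utility vectors for action $a$. For a scheme $\pi$, $\pi(\omega,s)$ is the probability of signal $s$ in state $\omega$; $p^\pi(\omega,s)=\mu(\omega)\pi(\omega,s)$ is the joint law, $p^\pi(s)=\sum_\omega p^\pi(\omega,s)$ (assumed positive for every $s\in S$), and $y^\pi_s\in\Delta^\Omega$, $y^\pi_s(\omega)=p^\pi(\omega,s)/p^\pi(s)$, is the posterior. Receiver action: for $x\in\Delta^\Omega$, $a(x)$ is an element of $\arg\max_{a\in A}\langle u_R(:,a),x\rangle$, ties being broken in favor of an action maximizing $\langle u_S(:,a),x\rangle$ (remaining ties by a fixed selection). $E_a=\{y\in\Delta^\Omega : a(y)=a\}$, and $a^\pi(s)=a(y^\pi_s)$. Known-commitment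 value: $BPR(\pi)=\mathbb{E}_{\omega\sim\mu,\,s\sim\pi(\omega)}[u_S(\omega,a^\pi(s))]$. Inference setting at round $k\ge 1$: let $Z\sim\mathsf{Multi}(k-1,p^\pi)$ (multinomial counts on $\Omega\times S$) and, for each $s$, independently $Y_s\sim\mathsf{Multi}(1,y^\pi_s)$ (one initial sample from each posterior). Counts are $\#(\omega,s)_k=Z(\omega,s)+Y_s(\omega)$ and the receiver's posterior estimate is $\hat y^\pi_{s,k}(\omega)=\#(\omega,s)_k/\sum_{\omega'}\#(\omega',s)_k$. On seeing signal $s$ at round $k$ the receiver takes action $a(\hat y^\pi_{s,k})$. The sender's round-$k$ reward is $IR_k(\pi)=\mathbb{E}_{\omega\sim\mu,\,s\sim\pi(\omega)}\,\mathbb{E}[u_S(\omega,a(\hat y^\pi_{s,k}))]$, where the current pair $(\omega,s)$ is independent of the counts; equivalently $IR_k(\pi)=\sum_{s}p^\pi(s)\sum_{a}\langle u_S(:,a),y^\pi_s\rangle\,\mathbb{P}[\hat y^\pi_{s,k}\in E_a]$. Let $C_{a,a'}=\{y\in\Delta^\Omega : \langle y,u_R(:,a)-u_R(:,a')\rangle=0\}$. For $x\in E_a$, $d(x)=\min_{a'\in A\setminus\{a\}}\min_{y\in C_{a,a'}}\|y-x\|_2$, where a minimum over the empty set is $+\infty$. The right-hand side of the bound is read as $+\infty$ if $d(\pi)=0$ and as $0$ if $d(\pi)=+\infty$. Entropy uses the natural logarithm: $H(\omega|s)=-\sum_{s\in S}p^\pi(s)\sum_{\omega\in\Omega}y^\pi_s(\omega)\log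 y^\pi_s(\omega)$ with $0\log 0=0$. *)

(* Defs.v *)
From HB Require Import structures.
From mathcomp Require Import all_boot all_order all_algebra.
From mathcomp Require Import all_classical all_reals all_analysis.
Set Implicit Arguments.
Unset Strict Implicit.
Unset Printing Implicit Defensive.
Import Order.TTheory GRing.Theory Num.Theory.
Local Open Scope classical_set_scope.
Local Open Scope ring_scope.

Definition simplex (R : realType) (X : finType) : set {ffun X -> R} :=
  [set p | (forall x, 0 <= p x) /\ \sum_x p x = 1].

Arguments simplex R X : clear implicits.

Definition dotp (R : realType) (X : finType) (u v : {ffun X -> R}) : R :=
  \sum_x u x * v x.

Definition norm2 (R : realType) (X : finType) (v : {ffun X -> R}) : R :=
  Num.sqrt (\sum_x v x ^+ 2).

Definition utility_vector (R : realType) (Omega A : finType)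
    (u : Omega -> A -> R) (a : A) : {ffun Omega -> R} :=
  [ffun w => u w a].

(* The law Multi(n, p) as a mass function on count vectors. Counts are at most
   n, so they are taken in 'I_n.+1; vectors of total different from n have
   mass 0. *)
Definition multinomial_pmf (R : realType) (T : finType) (n : nat)
    (p : {ffun T -> R}) (c : {ffun T -> 'I_n.+1}) : R :=
  if (\sum_t c t)%N == n then
    (n`!)%:R / (\prod_t (c t)`!)%N%:R * \prod_t p t ^+ c t
  else 0.

Section Persuasion.
Context (R : realType) (Omega A S : finType).
Implicit Types (uS uR : Omega -> A -> R) (mu x : {ffun Omega -> R})
  (scheme : Omega -> {ffun S -> R}) (act : {ffun Omega -> R} -> A).

(* act x is a best response of the receiver to the belief x, and is best for
   the sender among the best responses. Ties left by these two rules are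
   resolved by the function act itself, in an arbitrary way. *)
Definition receiver_action uS uR act : Prop :=
  forall x, simplex R Omega x ->
    (forall b, dotp (utility_vector uR b) x
               <= dotp (utility_vector uR (act x)) x) /\
    (forall b,
       (forall b', dotp (utility_vector uR b') x
                   <= dotp (utility_vector uR b) x) ->
       dotp (utility_vector uS b) x <= dotp (utility_vector uS (act x)) x).

Definition joint_law mu scheme : {ffun Omega * S -> R} :=
  [ffun ws => mu ws.1 * scheme ws.1 ws.2].

Definition signal_prob mu scheme (s : S) : R :=
  \sum_w joint_law mu scheme (w, s).

Definition posterior mu scheme (s : S) : {ffun Omega -> R} :=
  [ffun w => joint_law mu scheme (w, s) / signal_prob mu scheme s].

Definition BPR uS act mu scheme : R :=
  \sum_w mu w * \sum_s scheme w s * uS w (act (posterior mu scheme s)).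

Definition sample_count (n : nat) (Z : {ffun Omega * S -> 'I_n.+1})
    (Y : {ffun S -> {ffun Omega -> 'I_2}}) (w : Omega) (s : S) : nat :=
  (Z (w, s) + Y s w)%N.

Definition posterior_estimate (n : nat) (Z : {ffun Omega * S -> 'I_n.+1})
    (Y : {ffun S -> {ffun Omega -> 'I_2}}) (s : S) : {ffun Omega -> R} :=
  [ffun w => (sample_count Z Y w s)%:R / (\sum_w' sample_count Z Y w' s)%N%:R].

(* Expectation of F Z Y when Z ~ Multi(n, joint law) and, for each s,
   Y s ~ Multi(1, posterior s), all independent: the product law. *)
Definition count_expectation mu scheme (n : nat)
    (F : {ffun Omega * S -> 'I_n.+1} -> {ffun S -> {ffun Omega -> 'I_2}} -> R)
    : R :=
  \sum_(Z : {ffun Omega * S -> 'I_n.+1})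
    \sum_(Y : {ffun S -> {ffun Omega -> 'I_2}})
    multinomial_pmf (joint_law mu scheme) Z
    * (\prod_s multinomial_pmf (posterior mu scheme s) (Y s)) * F Z Y.

(* Meaningful for k >= 1: the round-k estimate uses k - 1 past rounds. *)
Definition IR uS act mu scheme (k : nat) : R :=
  \sum_w mu w * \sum_s scheme w s *
    count_expectation mu scheme
      (fun (Z : {ffun Omega * S -> 'I_k.-1.+1}) Y =>
         uS w (act (posterior_estimate Z Y s))).

Definition indifference_set uR (a a' : A) : set {ffun Omega -> R} :=
  [set y | simplex R Omega y /\
           dotp y (utility_vector uR a - utility_vector uR a') = 0].

(* The indifference sets are compact, so the infimum is a minimum whenever the
   set is nonempty; ereal_inf set0 = +oo. *)
Definition dist_act uR act x : \bar R :=
  \big[mine/+oo%E]_(a' | a' != act x)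
    ereal_inf [set (norm2 (y - x))%:E | y in indifference_set uR (act x) a'].

Definition dist_scheme uR act mu scheme : \bar R :=
  \big[mine/+oo%E]_s dist_act uR act (posterior mu scheme s).

(* 0 log 0 = 0 holds thanks to the factor 0. *)
Definition cond_entropy mu scheme : R :=
  - \sum_s signal_prob mu scheme s *
      \sum_w posterior mu scheme s w * ln (posterior mu scheme s w).

(* The bound is +oo when the distance is 0; this case is separate because
   +oo * 0 = 0 in \bar R. When the distance is +oo the bound is 0, since
   +oo^-1 = 0. *)
Definition inference_bound uR act mu scheme : \bar R :=
  let d := dist_scheme uR act mu scheme in
  if d == 0%E then +oo%E
  else (d^-1 * (Num.sqrt #|S|%:R)%:E
             * (Num.sqrt (cond_entropy mu scheme))%:E)%E.

End Persuasion.

(* Main.v *)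
(* If the estimated posterior z leads to another action than the true posterior
   y, the segment from y to z meets an indifference set, so |z - y| >= d. The
   estimate is unbiased (units of the multinomial counts can be exchanged
   between states with the same signal), and |z - y|^2 is at most a linear
   function of z on the simplex, which gives E|z - y|^2 <= 1 - |y|^2 <= H(y)
   without any moment of order two. Hence the probability D of a changed action,
   averaged over the signals, is at most H / d^2; as D <= 1, D^2 <= D, so
   D <= sqrt(H) / d, and utilities in [0, 1] lose at most D. *)
Require Import Defs.
From mathcomp Require Import all_boot all_order all_algebra.
From mathcomp Require Import all_classical all_reals all_analysis.
From mathcomp Require Import ring lra.
Set Implicit Arguments.
Unset Strict Implicit.
Unset Printing Implicit Defensive.
Import Order.TTheory GRing.Theory Num.Theory.
Local Open Scope ring_scope.

(** * Multinomial weights and moves of one unit between count vectors *)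

(** The multinomial mass without its factor [n!]. The bound [B] is decoupled from the total of the
    counts, so that vectors of totals [n] and [n.+1] share one type. *)
Definition multinomial_weight (R : realType) (T : finType) (B : nat)
    (p : {ffun T -> R}) (c : {ffun T -> 'I_B.+1}) : R :=
  \prod_t (p t ^+ c t / (c t)`!%:R).

(* [inord] sends [B.+1] to [0]: the increment is the intended one only when
   [c t < B]. *)
Definition incr_count (T : finType) (B : nat) (t : T)
    (c : {ffun T -> 'I_B.+1}) : {ffun T -> 'I_B.+1} :=
  [ffun u => inord (c u + (u == t))].

(** Truncated subtraction leaves [c] unchanged when [c t] is [0]. *)
Definition decr_count (T : finType) (B : nat) (t : T)
    (c : {ffun T -> 'I_B.+1}) : {ffun T -> 'I_B.+1} :=
  [ffun u => inord (c u - (u == t))].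

Lemma incr_countE (T : finType) (B : nat) (t u : T)
    (c : {ffun T -> 'I_B.+1}) :
  (c t < B)%N -> incr_count t c u = (c u + (u == t))%N :> nat.
Proof.
move=> ctB; rewrite ffunE inordK //.
by case: eqP => [->|_]; rewrite ?addn1 ?addn0.
Qed.

Lemma decr_countE (T : finType) (B : nat) (t u : T)
    (c : {ffun T -> 'I_B.+1}) :
  decr_count t c u = (c u - (u == t))%N :> nat.
Proof. by rewrite ffunE inordK // (leq_ltn_trans (leq_subr _ _)). Qed.

Lemma incr_countK (T : finType) (B : nat) (t : T) (c : {ffun T -> 'I_B.+1}) :
  (c t < B)%N -> decr_count t (incr_count t c) = c.
Proof.
by move=> ctB; apply/ffunP => u; apply/val_inj;
  rewrite /= decr_countE incr_countE// addnK.
Qed.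

Lemma decr_countK (T : finType) (B : nat) (t : T) (c : {ffun T -> 'I_B.+1}) :
  (0 < c t)%N -> incr_count t (decr_count t c) = c.
Proof.
move=> ct0; have ltB : (decr_count t c t < B)%N.
  by rewrite decr_countE eqxx subn1 -ltnS prednK.
apply/ffunP => u; apply/val_inj; rewrite /= incr_countE// decr_countE.
by case: eqP => [->|_]; rewrite ?subnK// subn0 addn0.
Qed.

(** The injection [f] serves two cases: the identity, for the total count, and [u |-> (u, s)], for
    the number of units carrying signal [s]. *)
Lemma sum_incr_count (T I : finType) (B : nat) (i : I) (f : I -> T)
    (c : {ffun T -> 'I_B.+1}) :
  injective f -> (c (f i) < B)%N ->
  (\sum_j incr_count (f i) c (f j) = (\sum_j c (f j)).+1)%N.
Proof.
move=> f_inj cB; under eq_bigr do rewrite incr_countE// (inj_eq f_inj).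
rewrite big_split /= -[RHS]addn1; congr addn.
by rewrite (bigD1 i)//= eqxx big1 ?addn0// => j /negPf ->.
Qed.

Lemma count_le_sum (T : finType) (B : nat) (t : T) (c : {ffun T -> 'I_B.+1}) :
  (c t <= \sum_u c u)%N.
Proof. by rewrite (bigD1 t)//= leq_addr. Qed.

(** The new count at [t] cancels the factor by which its factorial grows. *)
Lemma incr_count_weight (R : realType) (T : finType) (B : nat)
    (p : {ffun T -> R}) (t : T) (c : {ffun T -> 'I_B.+1}) :
  (c t < B)%N ->
  (incr_count t c t)%:R * multinomial_weight p (incr_count t c)
  = p t * multinomial_weight p c.
Proof.
move=> ctB; rewrite /multinomial_weight (bigD1 t)//= [in RHS](bigD1 t)//= !mulrA.
congr *%R; last first.
  by apply: eq_bigr => u ut; rewrite incr_countE// (negPf ut) addn0.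
rewrite incr_countE// eqxx addn1 factS natrM invfM exprS.
have c0 : (c t).+1%:R != 0 :> R by rewrite pnatr_eq0.
by rewrite -mulrA [X in _ * X]mulrCA mulVKf// mulrA.
Qed.

(* Removing one unit at [t] is a bijection from the count vectors of total
   [n.+1] with [0 < c t] onto those of total [n]. *)
Lemma multinomial_weight_shift (R : realType) (T : finType) (B n : nat)
    (p : {ffun T -> R}) (t : T) (g : {ffun T -> 'I_B.+1} -> R) :
  (n < B)%N ->
  \sum_(c : {ffun T -> 'I_B.+1} | (\sum_u c u)%N == n.+1)
     multinomial_weight p c * (c t)%:R * g c
  = p t * \sum_(c : {ffun T -> 'I_B.+1} | (\sum_u c u)%N == n)
     multinomial_weight p c * g (incr_count t c).
Proof.
move=> nB; rewrite (bigID (fun c : {ffun T -> 'I_B.+1} => 0 < c t)%N) /=.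
rewrite [X in _ + X]big1 ?addr0; last first.
  by move=> c /andP[_]; rewrite lt0n negbK => /eqP ->; rewrite mulr0 mul0r.
rewrite (reindex_onto (incr_count t) (decr_count t)) /=; last first.
  by move=> c /andP[_ ct0]; rewrite decr_countK.
rewrite big_distrr /=; apply: eq_big => [c|c].
  apply/idP/idP => [/andP[/andP[/eqP sn ct0] /eqP ck]|/eqP sn].
    (* If [c t] were [B], [inord] would wrap the increment to [0], against [ct0]. *)
    have ctB : (c t < B)%N.
      rewrite ltn_neqAle -ltnS ltn_ord andbT; apply/eqP => ctB.
      move: ct0; rewrite ffunE /inord /insubd eqxx addn1 insubF ?ctB ?ltnn//.
    by move: sn; rewrite (sum_incr_count (@inj_id T))// => -[->].
  have ctB : (c t < B)%N by rewrite (leq_ltn_trans _ nB)// -sn count_le_sum.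
  by rewrite (sum_incr_count (@inj_id T))// sn eqxx incr_countK// eqxx
    incr_countE// eqxx addn1.
move=> /andP[/andP[_ ct0] /eqP ck].
have ctB : (c t < B)%N.
  move: ct0; rewrite -{2}ck decr_countE eqxx subn1 => ct0.
  by rewrite -ltnS prednK.
by rewrite (mulrC (multinomial_weight _ _)) incr_count_weight// mulrA.
Qed.

(** The multinomial theorem divided by [n!], by induction on [n]: the factor [n.+1] is the total of
    the counts, and shifting one unit at each [t] leads back to total [n]. *)
Lemma multinomial_weight_sum (R : realType) (T : finType) (B n : nat)
    (p : {ffun T -> R}) :
  (n <= B)%N ->
  \sum_(c : {ffun T -> 'I_B.+1} | (\sum_u c u)%N == n) multinomial_weight p c
  = (\sum_t p t) ^+ n / n`!%:R.
Proof.
elim: n => [_|n IH nB].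
  rewrite (big_pred1 [ffun=> ord0]) => [|c /=].
    by rewrite fact0 expr0 divr1 /multinomial_weight big1// => t _;
      rewrite ffunE expr0 fact0 divr1.
  rewrite sum_nat_eq0; apply/forallP/eqP => [c0|->] /=.
    by apply/ffunP => t; rewrite ffunE; apply/val_inj/eqP; exact: (implyP (c0 t)).
  by move=> t; rewrite ffunE.
have n0 : n.+1%:R != 0 :> R by rewrite pnatr_eq0.
apply: (mulfI n0); rewrite factS natrM invfM exprS [in RHS]mulrCA mulVKf//.
rewrite -mulrA -IH ?(ltnW nB)// mulr_suml mulr_sumr.
transitivity (\sum_(c : {ffun T -> 'I_B.+1} | (\sum_u c u)%N == n.+1)
    \sum_t multinomial_weight p c * (c t)%:R * 1).
  apply: eq_bigr => c /eqP <-.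
  by rewrite -mulr_suml mulr1 -mulr_sumr natr_sum mulrC.
rewrite exchange_big; apply: eq_bigr => t _ /=.
rewrite multinomial_weight_shift//.
by congr *%R; apply: eq_bigr => c _; rewrite mulr1.
Qed.

(** * The multinomial law: total mass, exchange of units, mean *)

Lemma multinomial_pmfE (R : realType) (T : finType) (n : nat)
    (p : {ffun T -> R}) (c : {ffun T -> 'I_n.+1}) :
  multinomial_pmf p c =
  if (\sum_t c t)%N == n then n`!%:R * multinomial_weight p c else 0.
Proof.
rewrite /multinomial_pmf; case: ifP => // _.
by rewrite /multinomial_weight big_split /= prodfV natr_prod -mulrA (mulrC _^-1).
Qed.

Lemma multinomial_pmf_ge0 (R : realType) (T : finType) (n : nat)
    (p : {ffun T -> R}) (c : {ffun T -> 'I_n.+1}) :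
  (forall t, 0 <= p t) -> 0 <= multinomial_pmf p c.
Proof.
move=> p0; rewrite /multinomial_pmf; case: ifP => // _.
by rewrite mulr_ge0// ?divr_ge0// prodr_ge0// => t _; rewrite exprn_ge0.
Qed.

Lemma sum_multinomial_pmf (R : realType) (T : finType) (n : nat)
    (p : {ffun T -> R}) (g : {ffun T -> 'I_n.+1} -> R) :
  \sum_c multinomial_pmf p c * g c =
  n`!%:R * \sum_(c : {ffun T -> 'I_n.+1} | (\sum_t c t)%N == n)
     multinomial_weight p c * g c.
Proof.
rewrite mulr_sumr [RHS]big_mkcond; apply: eq_bigr => c _.
by rewrite multinomial_pmfE; case: ifP; rewrite ?mul0r// mulrA.
Qed.

Lemma multinomial_pmf_sum1 (R : realType) (T : finType) (n : nat)
    (p : {ffun T -> R}) :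
  \sum_t p t = 1 -> \sum_(c : {ffun T -> 'I_n.+1}) multinomial_pmf p c = 1.
Proof.
move=> p1; under eq_bigr do rewrite -[multinomial_pmf _ _]mulr1.
rewrite sum_multinomial_pmf; under eq_bigr do rewrite mulr1.
by rewrite multinomial_weight_sum// p1 expr1n mul1r divff// pnatr_eq0 -lt0n fact_gt0.
Qed.

(** After removal of one unit both sides carry the factor [p t * p t'], and the remaining sums agree
    because [g] does not see where the unit is put back. *)
Lemma multinomial_pmf_exchange (R : realType) (T : finType) (n : nat)
    (p : {ffun T -> R}) (t t' : T) (g : {ffun T -> 'I_n.+1} -> R) :
  (forall c : {ffun T -> 'I_n.+1}, (c t < n)%N -> (c t' < n)%N ->
     g (incr_count t c) = g (incr_count t' c)) ->
  p t' * \sum_c multinomial_pmf p c * ((c t)%:R * g c)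
  = p t * \sum_c multinomial_pmf p c * ((c t')%:R * g c).
Proof.
case: n g => [|n] g gtt'.
  have c0 (c : {ffun T -> 'I_1}) u : (c u)%:R = 0 :> R by rewrite ord1.
  by rewrite !big1 ?mulr0// => c _; rewrite c0 mul0r mulr0.
rewrite !sum_multinomial_pmf.
under eq_bigr do rewrite mulrA.
under [in RHS]eq_bigr do rewrite mulrA.
rewrite !multinomial_weight_shift// mulrCA [RHS]mulrCA (mulrCA (p t')).
do 3!congr *%R; apply: eq_bigr => c /eqP sn; rewrite gtt'// ltnS.
  by apply: (leq_trans (count_le_sum t c)); rewrite sn.
by apply: (leq_trans (count_le_sum t' c)); rewrite sn.
Qed.

Lemma multinomial1_mean (R : realType) (T : finType) (p : {ffun T -> R})
    (t : T) :
  \sum_(c : {ffun T -> 'I_2}) multinomial_pmf p c * (c t)%:R = p t.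
Proof.
rewrite sum_multinomial_pmf mul1r.
transitivity (\sum_(c : {ffun T -> 'I_2} | (\sum_t c t)%N == 1)
    multinomial_weight p c * (c t)%:R * 1).
  by apply: eq_bigr => c _; rewrite mulr1.
rewrite multinomial_weight_shift//.
under eq_bigr do rewrite mulr1.
by rewrite multinomial_weight_sum// fact0 divr1 mulr1.
Qed.

(** * Joint law, posteriors and expectations over the counts *)

Lemma posterior_simplex (R : realType) (Omega S : finType)
    (mu : {ffun Omega -> R}) (scheme : Omega -> {ffun S -> R}) (s : S) :
  simplex R Omega mu -> (forall w, simplex R S (scheme w)) ->
  0 < signal_prob mu scheme s -> simplex R Omega (posterior mu scheme s).
Proof.
move=> [mu0 _] hs ps; split=> [w|].
  by rewrite !ffunE divr_ge0 ?(ltW ps)// mulr_ge0//; case: (hs w).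
under eq_bigr do rewrite ffunE.
by rewrite -mulr_suml divff// gt_eqF.
Qed.

Lemma joint_law_simplex (R : realType) (Omega S : finType)
    (mu : {ffun Omega -> R}) (scheme : Omega -> {ffun S -> R}) :
  simplex R Omega mu -> (forall w, simplex R S (scheme w)) ->
  simplex R (Omega * S)%type (joint_law mu scheme).
Proof.
move=> [mu0 mu1] hs; split=> [ws|].
  by rewrite !ffunE mulr_ge0//; case: (hs ws.1).
under eq_bigr do rewrite ffunE.
rewrite -(pair_bigA _ (fun w s => mu w * scheme w s)) /= -[RHS]mu1.
apply: eq_bigr => w _; rewrite -mulr_sumr.
by case: (hs w) => _ ->; rewrite mulr1.
Qed.

Lemma signal_prob_sum1 (R : realType) (Omega S : finType)
    (mu : {ffun Omega -> R}) (scheme : Omega -> {ffun S -> R}) :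
  simplex R Omega mu -> (forall w, simplex R S (scheme w)) ->
  \sum_s signal_prob mu scheme s = 1.
Proof.
move=> hmu hs; rewrite exchange_big pair_big /=.
by case: (joint_law_simplex hmu hs) => _ <-; apply: eq_bigr => -[].
Qed.

(** Samples in which some [Y s] does not have total 1 have mass 0, so the comparison is asked only
    where every signal has exactly one initial unit. *)
Lemma count_expectation_le (R : realType) (Omega S : finType)
    (mu : {ffun Omega -> R}) (scheme : Omega -> {ffun S -> R}) (n : nat)
    (F G : {ffun Omega * S -> 'I_n.+1} -> {ffun S -> {ffun Omega -> 'I_2}} -> R) :
  (forall ws, 0 <= joint_law mu scheme ws) ->
  (forall s w, 0 <= posterior mu scheme s w) ->
  (forall Z (Y : {ffun S -> {ffun Omega -> 'I_2}}),
     (forall s, (\sum_w Y s w)%N = 1) -> F Z Y <= G Z Y) ->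
  count_expectation mu scheme F <= count_expectation mu scheme G.
Proof.
move=> p0 y0 FG; apply: ler_sum => Z _; apply: ler_sum => Y _.
have [Y1|] := boolP [forall s, (\sum_w Y s w)%N == 1].
  apply: ler_wpM2l; last by apply: FG => s; apply/eqP/(forallP Y1).
  by rewrite mulr_ge0 ?multinomial_pmf_ge0// prodr_ge0// => s _;
    rewrite multinomial_pmf_ge0.
rewrite negb_forall => /existsP[s /negPf Ys].
have Y0 : multinomial_pmf (posterior mu scheme s) (Y s) = 0.
  by rewrite /multinomial_pmf Ys.
by rewrite (bigD1 s)//= Y0 !(mul0r, mulr0).
Qed.

Lemma count_expectationD (R : realType) (Omega S : finType)
    (mu : {ffun Omega -> R}) (scheme : Omega -> {ffun S -> R}) (n : nat)
    (F G : {ffun Omega * S -> 'I_n.+1} -> {ffun S -> {ffun Omega -> 'I_2}} -> R) :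
  count_expectation mu scheme (fun Z Y => F Z Y + G Z Y) =
  count_expectation mu scheme F + count_expectation mu scheme G.
Proof.
rewrite -big_split; apply: eq_bigr => Z _; rewrite -big_split /=.
by apply: eq_bigr => Y _; rewrite mulrDr.
Qed.

Lemma count_expectation_sum (R : realType) (I Omega S : finType)
    (mu : {ffun Omega -> R}) (scheme : Omega -> {ffun S -> R}) (n : nat)
    (a : I -> R)
    (F : I -> {ffun Omega * S -> 'I_n.+1} -> {ffun S -> {ffun Omega -> 'I_2}} -> R) :
  count_expectation mu scheme (fun Z Y => \sum_i a i * F i Z Y) =
  \sum_i a i * count_expectation mu scheme (F i).
Proof.
under [RHS]eq_bigr do rewrite mulr_sumr.
rewrite [RHS]exchange_big; apply: eq_bigr => Z _ /=.
under [RHS]eq_bigr do rewrite mulr_sumr.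
rewrite [RHS]exchange_big; apply: eq_bigr => Y _ /=.
by rewrite mulr_sumr; apply: eq_bigr => i _; rewrite mulrCA.
Qed.

Lemma count_expectation_marginal (R : realType) (Omega S : finType)
    (mu : {ffun Omega -> R}) (scheme : Omega -> {ffun S -> R}) (n : nat) (s : S)
    (F : {ffun Omega * S -> 'I_n.+1} -> {ffun Omega -> 'I_2} -> R) :
  (forall s', \sum_w posterior mu scheme s' w = 1) ->
  count_expectation mu scheme (fun Z Y => F Z (Y s)) =
  \sum_Z multinomial_pmf (joint_law mu scheme) Z *
    \sum_y multinomial_pmf (posterior mu scheme s) y * F Z y.
Proof.
move=> y1; apply: eq_bigr => Z _.
under eq_bigr do rewrite -mulrA.
rewrite -mulr_sumr; congr *%R.
(* With [F] inserted at [s] and 1 elsewhere, the sum over [Y] is a sum of products, which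
   distributes into a product of sums; the factors at the other signals are total masses 1. *)
pose G s' (y : {ffun Omega -> 'I_2}) :=
  multinomial_pmf (posterior mu scheme s') y * (if s' == s then F Z y else 1).
transitivity (\sum_(Y : {ffun S -> {ffun Omega -> 'I_2}}) \prod_s' G s' (Y s')).
  apply: eq_bigr => Y _; rewrite big_split /=; congr *%R.
  by rewrite -big_mkcond big_pred1_eq.
rewrite -bigA_distr_bigA (bigD1 s)//= [X in _ * X]big1 => [|s' /negPf s's].
  by rewrite mulr1; apply: eq_bigr => y _; rewrite /G eqxx.
by under eq_bigr do rewrite /G s's mulr1; rewrite multinomial_pmf_sum1.
Qed.

Lemma count_expectation_cst (R : realType) (Omega S : finType)
    (mu : {ffun Omega -> R}) (scheme : Omega -> {ffun S -> R}) (n : nat)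
    (a : R) :
  \sum_ws joint_law mu scheme ws = 1 ->
  (forall s, \sum_w posterior mu scheme s w = 1) ->
  count_expectation mu scheme
    (fun (_ : {ffun Omega * S -> 'I_n.+1}) _ => a) = a.
Proof.
move=> p1 y1; rewrite /count_expectation.
have Y1 : \sum_(Y : {ffun S -> {ffun Omega -> 'I_2}})
    \prod_s multinomial_pmf (posterior mu scheme s) (Y s) = 1.
  rewrite -(bigA_distr_bigA (fun s => multinomial_pmf (posterior mu scheme s))).
  by rewrite big1// => s _; rewrite multinomial_pmf_sum1.
under eq_bigr do rewrite -mulr_suml -mulr_sumr Y1 mulr1.
by rewrite -mulr_suml multinomial_pmf_sum1// mul1r.
Qed.

(** * The posterior estimate and its mean *)

(** The initial unit of signal [s] makes the denominator positive. *)
Lemma posterior_estimate_simplex (R : realType) (Omega S : finType) (n : nat)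
    (Z : {ffun Omega * S -> 'I_n.+1}) (Y : {ffun S -> {ffun Omega -> 'I_2}})
    (s : S) :
  (\sum_w Y s w)%N = 1 -> simplex R Omega (posterior_estimate R Z Y s).
Proof.
move=> Y1; split=> [w|]; first by rewrite ffunE divr_ge0.
under eq_bigr do rewrite ffunE.
rewrite -mulr_suml -natr_sum divff// pnatr_eq0 /sample_count.
by rewrite big_split /= Y1 addn1.
Qed.

(** With [N] past units of signal [s], these contribute [E[N / (N + 1)]] times the posterior, by
    exchange, and the initial unit contributes [E[1 / (N + 1)]] times it. *)
Lemma posterior_estimate_unbiased (R : realType) (Omega S : finType)
    (mu : {ffun Omega -> R}) (scheme : Omega -> {ffun S -> R}) (n : nat)
    (w : Omega) (s : S) :
  signal_prob mu scheme s != 0 ->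
  \sum_ws joint_law mu scheme ws = 1 ->
  (forall s', \sum_w' posterior mu scheme s' w' = 1) ->
  count_expectation mu scheme
    (fun (Z : {ffun Omega * S -> 'I_n.+1}) Y => posterior_estimate R Z Y s w)
  = posterior mu scheme s w.
Proof.
move=> ps0 p1 y1.
pose N (Z : {ffun Omega * S -> 'I_n.+1}) := (\sum_w' Z (w', s))%N.
pose g Z : R := (N Z).+1%:R^-1.
pose F (Z : {ffun Omega * S -> 'I_n.+1}) (y : {ffun Omega -> 'I_2}) : R :=
  (Z (w, s) + y w)%:R / (N Z + \sum_w' y w')%:R.
transitivity (count_expectation mu scheme (fun Z Y => F Z (Y s))).
  apply: eq_bigr => Z _; apply: eq_bigr => Y _; congr *%R.
  by rewrite ffunE /sample_count big_split.
rewrite count_expectation_marginal// {}/F.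
(* Averaging over the initial sample replaces its count at [w] by the posterior mass of [w]; the
   denominator is [N + 1] wherever the mass is nonzero. *)
transitivity (\sum_Z multinomial_pmf (joint_law mu scheme) Z *
    ((Z (w, s))%:R * g Z + posterior mu scheme s w * g Z)).
  apply: eq_bigr => Z _; congr *%R.
  rewrite -(multinomial1_mean (posterior mu scheme s) w).
  rewrite -[(Z (w, s))%:R]mulr1 -[X in _ * X * _](multinomial_pmf_sum1 1 (y1 s)).
  rewrite mulr_sumr !mulr_suml -big_split; apply: eq_bigr => y _ /=.
  rewrite {1}/multinomial_pmf; case: ifPn => [/eqP sy|sy]; last first.
    by rewrite /multinomial_pmf (negPf sy) !(mul0r, mulr0) addr0.
  rewrite /multinomial_pmf sy eqxx addn1 -/(g Z) natrD; ring.
(* The exchange identity between [(w, s)] and [(w', s)], summed over [w']. It applies because [g]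
   depends on [Z] through [N] alone, which grows by one in either case. *)
have ex : signal_prob mu scheme s *
    \sum_Z multinomial_pmf (joint_law mu scheme) Z * ((Z (w, s))%:R * g Z)
  = joint_law mu scheme (w, s) *
    \sum_Z multinomial_pmf (joint_law mu scheme) Z * ((N Z)%:R * g Z).
  rewrite /signal_prob mulr_suml.
  transitivity (joint_law mu scheme (w, s) * \sum_w'
      \sum_Z multinomial_pmf (joint_law mu scheme) Z * ((Z (w', s))%:R * g Z)).
    rewrite mulr_sumr; apply: eq_bigr => w' _.
    apply: multinomial_pmf_exchange => Z Zw Zw'; congr (_.+1%:R^-1).
    have inj_s : injective (fun u : Omega => (u, s)) by move=> u v [].
    by rewrite /N (sum_incr_count inj_s Zw) (sum_incr_count inj_s Zw').
  rewrite exchange_big; congr *%R; apply: eq_bigr => Z _ /=.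
  by rewrite -mulr_sumr -mulr_suml /N natr_sum.
under eq_bigr do rewrite mulrDr.
rewrite big_split /=.
have -> : \sum_Z multinomial_pmf (joint_law mu scheme) Z * ((Z (w, s))%:R * g Z)
    = posterior mu scheme s w *
      \sum_Z multinomial_pmf (joint_law mu scheme) Z * ((N Z)%:R * g Z).
  by apply: (mulfI ps0); rewrite ex [posterior _ _ _ _]ffunE [RHS]mulrA
    (mulrC (signal_prob _ _ _)) divfK.
have -> : \sum_Z multinomial_pmf (joint_law mu scheme) Z *
      (posterior mu scheme s w * g Z)
    = posterior mu scheme s w *
      \sum_Z multinomial_pmf (joint_law mu scheme) Z * g Z.
  by rewrite mulr_sumr; apply: eq_bigr => Z _; rewrite mulrCA.
rewrite -mulrDr -big_split /=.
rewrite (eq_bigr (fun Z => multinomial_pmf (joint_law mu scheme) Z)).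
  by rewrite multinomial_pmf_sum1// mulr1.
by move=> Z _; rewrite -mulrDr -[X in _ + X]mul1r -mulrDl natr1 divff ?mulr1.
Qed.

(** * Indifference sets and the distance to a change of action *)

Lemma crossing_indifference_set (R : realType) (Omega A : finType)
    (uS uR : Omega -> A -> R) (act : {ffun Omega -> R} -> A)
    (y z : {ffun Omega -> R}) :
  receiver_action uS uR act -> simplex R Omega y -> simplex R Omega z ->
  exists2 x, indifference_set uR (act y) (act z) x &
    norm2 (x - y) <= norm2 (z - y).
Proof.
move=> hact hy hz.
(* The receiver's gain from [act y] over [act z]: it is affine along the segment, and optimality of
   the two actions gives its signs at the ends. *)
pose f x := dotp x (utility_vector uR (act y) - utility_vector uR (act z)).
have fE x : f x = dotp (utility_vector uR (act y)) x
                - dotp (utility_vector uR (act z)) x.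
  by rewrite /f /dotp -sumrB; apply: eq_bigr => w _; rewrite !ffunE; ring.
have fy : 0 <= f y by rewrite fE subr_ge0; case: (hact y hy) => + _; apply.
have fz : f z <= 0 by rewrite fE subr_le0; case: (hact z hz) => + _; apply.
(* The zero of [f] on the segment. If the denominator vanishes, both values are 0 by their signs,
   and division by zero gives [t = 0], that is, the point [y]. *)
pose t := f y / (f y - f z).
have [t0 t1] : 0 <= t /\ t <= 1.
  rewrite /t; have [->|fyz] := eqVneq (f y - f z) 0; first by rewrite invr0 mulr0.
  have fyz0 : 0 < f y - f z by rewrite lt_neqAle eq_sym fyz; lra.
  by split; [apply: divr_ge0; lra | rewrite ler_pdivrMr// mul1r; lra].
have ft : f y - t * (f y - f z) = 0.
  rewrite /t; have [fyz|fyz] := eqVneq (f y - f z) 0; first by rewrite fyz mulr0; lra.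
  by rewrite divfK// subrr.
exists [ffun w => y w + t * (z w - y w)].
  split; first split=> [w|].
  - rewrite ffunE; case: hy => /(_ w) yw _; case: hz => /(_ w) zw _; nra.
  - under eq_bigr do rewrite ffunE.
    rewrite big_split /= -mulr_sumr sumrB.
    by case: hy => _ ->; case: hz => _ ->; rewrite subrr mulr0 addr0.
  rewrite -[RHS]ft /f /dotp -sumrB mulr_sumr -sumrB.
  by apply: eq_bigr => w _; rewrite !ffunE; ring.
apply: ler_wsqrtr; apply: ler_sum => w _; rewrite !ffunE addrAC subrr add0r.
by rewrite exprMn ler_piMl ?sqr_ge0// expr_le1.
Qed.

(** As [act z] differs from the action at the posterior, it is one of the competitors in the
    minimum, and the crossing point bounds its term. *)
Lemma dist_scheme_le (R : realType) (Omega A S : finType)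
    (uS uR : Omega -> A -> R) (mu : {ffun Omega -> R})
    (scheme : Omega -> {ffun S -> R}) (act : {ffun Omega -> R} -> A)
    (s : S) (z : {ffun Omega -> R}) :
  receiver_action uS uR act -> simplex R Omega (posterior mu scheme s) ->
  simplex R Omega z -> act z != act (posterior mu scheme s) ->
  (dist_scheme uR act mu scheme <= (norm2 (z - posterior mu scheme s))%:E)%E.
Proof.
move=> hact hy hz az.
have [x xC xy] := crossing_indifference_set hact hy hz.
apply: (bigmin_inf s) => //; apply: (bigmin_inf (act z)) => //.
rewrite (le_trans (y := (norm2 (x - posterior mu scheme s))%:E)) ?lee_fin//.
by apply: ereal_inf_lbound; exists x.
Qed.

Lemma dist_scheme_ge0 (R : realType) (Omega A S : finType)
    (uR : Omega -> A -> R) (mu : {ffun Omega -> R})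
    (scheme : Omega -> {ffun S -> R}) (act : {ffun Omega -> R} -> A) :
  (0 <= dist_scheme uR act mu scheme)%E.
Proof.
apply: le_bigmin => [|s _]; first exact: leey.
apply: le_bigmin => [|a _]; first exact: leey.
by apply: le_ereal_inf_tmp => _ [y _ <-]; rewrite lee_fin sqrtr_ge0.
Qed.

(** * Entropy and the squared distance *)

(** Termwise, from [ln v <= v - 1] multiplied by [v]. *)
Lemma gini_le_entropy (R : realType) (X : finType) (y : {ffun X -> R}) :
  simplex R X y -> 1 - \sum_x y x ^+ 2 <= - \sum_x y x * ln (y x).
Proof.
move=> [y0 y1]; rewrite -{1}y1 -sumrB -sumrN; apply: ler_sum => x _.
have [->|yx] := eqVneq (y x) 0; first by rewrite expr0n mul0r subrr oppr0.
have yx0 : 0 < y x by rewrite lt_neqAle eq_sym yx y0.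
have := @le_ln1Dx R (y x - 1); rewrite addrCA subrr addr0 => ln_le.
have {}ln_le : ln (y x) <= y x - 1 by apply: ln_le; lra.
nra.
Qed.

(* Since [z w ^+ 2 <= z w] on the simplex, the squared distance is dominated by
   a linear function of [z]. *)
Lemma norm2_sqr_le (R : realType) (X : finType) (y z : {ffun X -> R}) :
  simplex R X z ->
  norm2 (z - y) ^+ 2 <= \sum_w (1 + \sum_x y x ^+ 2 - 2 * y w) * z w.
Proof.
move=> [z0 z1]; rewrite sqr_sqrtr; last by apply: sumr_ge0 => w _; rewrite sqr_ge0.
set N := \sum_x y x ^+ 2.
(* Since [z] sums to 1, the constant [N] can be spread over the states as [y w ^+ 2], which makes
   the comparison termwise. *)
have -> : \sum_w (1 + N - 2 * y w) * z w =
    \sum_w (z w - 2 * y w * z w + y w ^+ 2).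
  rewrite big_split /= sumrB z1 -/N.
  under eq_bigr do rewrite mulrBl.
  by rewrite sumrB -mulr_sumr z1 mulr1 addrAC.
apply: ler_sum => w _; rewrite !ffunE.
have zw1 : z w <= 1.
  by rewrite -z1 (bigD1 w)//= lerDl sumr_ge0.
have := z0 w; nra.
Qed.

(** * Probability of a changed action and loss of the sender *)

(** A Chebyshev argument. The number [e] stands for [1 / d]; an infinite distance is covered by
    [e = 0], where the hypothesis forbids any change of action. *)
Lemma disagreement_prob_le (R : realType) (Omega A S : finType)
    (mu : {ffun Omega -> R}) (scheme : Omega -> {ffun S -> R})
    (act : {ffun Omega -> R} -> A)
    (n : nat) (s : S) (e : R) :
  simplex R Omega mu -> (forall w, simplex R S (scheme w)) ->
  (forall s, 0 < signal_prob mu scheme s) ->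
  (forall z, simplex R Omega z -> act z != act (posterior mu scheme s) ->
     1 <= e * norm2 (z - posterior mu scheme s)) ->
  count_expectation mu scheme
    (fun (Z : {ffun Omega * S -> 'I_n.+1}) Y =>
      (act (posterior_estimate R Z Y s) != act (posterior mu scheme s))%:R)
  <= e ^+ 2 * - \sum_w posterior mu scheme s w * ln (posterior mu scheme s w).
Proof.
move=> hmu hs ps he.
have hp := joint_law_simplex hmu hs.
have hy s' := posterior_simplex hmu hs (ps s').
set y := posterior mu scheme s in he *; set N := \sum_w y w ^+ 2.
apply: (@le_trans _ _ (e ^+ 2 * (1 - N))); last first.
  rewrite ler_wpM2l ?sqr_ge0//; exact: gini_le_entropy (hy s).
apply: (@le_trans _ _ (count_expectation mu scheme
  (fun (Z : {ffun Omega * S -> 'I_n.+1}) Y =>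
     \sum_w e ^+ 2 * (1 + N - 2 * y w) * posterior_estimate R Z Y s w))).
  apply: count_expectation_le => [||Z Y Y1]; first by case: hp.
    by move=> s'; case: (hy s').
  have hz := posterior_estimate_simplex R Z (Y1 s).
  set z := posterior_estimate R Z Y s in hz *.
  under eq_bigr do rewrite -mulrA.
  rewrite -mulr_sumr.
  apply: (@le_trans _ _ (e ^+ 2 * norm2 (z - y) ^+ 2)); last first.
    by rewrite ler_wpM2l ?sqr_ge0// norm2_sqr_le.
  rewrite -exprMn; have [_|az] := eqVneq; first exact: sqr_ge0.
  by apply: exprn_ege1; exact: he.
rewrite (count_expectation_sum _ _ (fun w => e ^+ 2 * (1 + N - 2 * y w))).
have unbiased w := posterior_estimate_unbiased n w (lt0r_neq0 (ps s))
  hp.2 (fun s' => (hy s').2).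
(* By unbiasedness the mean of the linear bound is its value at [y], which sums to
   [e ^+ 2 * (1 + N - 2 * N)]. *)
rewrite (eq_bigr (fun w => e ^+ 2 * ((1 + N) * y w - 2 * y w ^+ 2))) => [|w _].
  rewrite -mulr_sumr sumrB -!mulr_sumr (hy s).2 -/N.
  by apply: ler_wpM2l; [exact: sqr_ge0|lra].
by rewrite unbiased -/y; ring.
Qed.

(** For a fixed state, signal and counts, the two rewards differ only if the actions do, and then by
    at most 1. *)
Lemma BPR_sub_IR_le (R : realType) (Omega A S : finType)
    (uS : Omega -> A -> R) (mu : {ffun Omega -> R})
    (scheme : Omega -> {ffun S -> R}) (act : {ffun Omega -> R} -> A) (k : nat) :
  simplex R Omega mu -> (forall w, simplex R S (scheme w)) ->
  (forall s, 0 < signal_prob mu scheme s) ->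
  (forall w a, 0 <= uS w a <= 1) ->
  BPR uS act mu scheme - IR uS act mu scheme k <=
  \sum_s signal_prob mu scheme s * count_expectation mu scheme
    (fun (Z : {ffun Omega * S -> 'I_k.-1.+1}) Y =>
      (act (posterior_estimate R Z Y s) != act (posterior mu scheme s))%:R).
Proof.
move=> hmu hs ps huS.
have hp := joint_law_simplex hmu hs.
have hy s' := posterior_simplex hmu hs (ps s').
rewrite /BPR /IR -sumrB.
under [leRHS]eq_bigr do rewrite mulr_suml.
rewrite [leRHS]exchange_big /=; apply: ler_sum => w _.
rewrite -mulrBr -sumrB mulr_sumr; apply: ler_sum => s _.
rewrite ffunE /= -mulrBr mulrA ler_wpM2l//.
  by case: hp => /(_ (w, s)); rewrite ffunE.
rewrite lerBlDl -count_expectationD.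
(* The known-commitment reward is written as the expectation of a constant, so that both sides are
   compared under the law of the counts. *)
rewrite -[leLHS](@count_expectation_cst _ _ _ mu scheme k.-1); last 2 first.
- by case: hp.
- by move=> s'; case: (hy s').
apply: count_expectation_le => [||Z Y _]; first by case: hp.
  by move=> s'; case: (hy s').
have [->|_] := eqVneq (act (posterior_estimate R Z Y s)) _; first by rewrite addr0.
have /andP[_] := huS w (act (posterior mu scheme s)).
have /andP[+ _] := huS w (act (posterior_estimate R Z Y s)).
rewrite /=; lra.
Qed.

Theorem corollary1 (R : realType) (Omega A S : finType)
    (uS uR : Omega -> A -> R) (mu : {ffun Omega -> R})
    (scheme : Omega -> {ffun S -> R}) (act : {ffun Omega -> R} -> A)
    (hmu : simplex R Omega mu)
    (hscheme : forall w, simplex R S (scheme w))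
    (hsignal : forall s, 0 < signal_prob mu scheme s)
    (hact : receiver_action uS uR act)
    (huS : forall w a, 0 <= uS w a <= 1)
    (k : nat) (hk : (1 <= k)%N) :
  ((BPR uS act mu scheme - IR uS act mu scheme k)%:E
     <= inference_bound uR act mu scheme)%E.
Proof.
rewrite /inference_bound; case: eqVneq => [_|d0]; first exact: leey.
have dge0 := dist_scheme_ge0 uR mu scheme act.
(* The real number [e] is the inverse distance, which treats finite and infinite distances at
   once. *)
have [e e0 [de he]] : exists2 e : R, 0 <= e &
    (dist_scheme uR act mu scheme)^-1%E = e%:E /\
    forall s z, simplex R Omega z -> act z != act (posterior mu scheme s) ->
      1 <= e * norm2 (z - posterior mu scheme s).
  have le_d s z hz := @dist_scheme_le _ _ _ _ _ _ _ _ _ s z hact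
    (posterior_simplex hmu hscheme (hsignal s)) hz.
  case: (dist_scheme _ _ _ _) d0 dge0 le_d => [d||]//.
    rewrite eqe lee_fin => d0 dge0 le_d; exists d^-1; first by rewrite invr_ge0.
    split=> [|s z hz az]; first by rewrite inver (negPf d0).
    have dgt0 : 0 < d by rewrite lt_neqAle eq_sym d0.
    by rewrite mulrC ler_pdivlMr// mul1r -lee_fin le_d.
  (* At infinite distance a changed action would put [+oo] below a real norm. *)
  move=> _ _ le_d; exists 0 => //; split=> [|s z hz az]; first exact: invey.
  by have := le_d s z hz az.
rewrite de -!EFinM lee_fin.
set D := \sum_s signal_prob mu scheme s * count_expectation mu scheme
    (fun (Z : {ffun Omega * S -> 'I_k.-1.+1}) Y =>
      (act (posterior_estimate R Z Y s) != act (posterior mu scheme s))%:R) : R.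
apply: (@le_trans _ _ D); first exact: BPR_sub_IR_le.
have hp := joint_law_simplex hmu hscheme.
have hy s' := posterior_simplex hmu hscheme (hsignal s').
have [D0|D0] := leP D 0.
  by rewrite (le_trans D0)// !mulr_ge0 ?sqrtr_ge0.
have D1 : D <= 1.
  rewrite -(signal_prob_sum1 hmu hscheme); apply: ler_sum => s _.
  rewrite ler_piMr ?(ltW (hsignal s))//.
  rewrite -[leRHS](@count_expectation_cst _ _ _ mu scheme k.-1); last 2 first.
  - by case: hp.
  - by move=> s'; case: (hy s').
  apply: count_expectation_le => [||Z Y _]; last by rewrite lern1 leq_b1.
  - by case: hp.
  - by move=> s'; case: (hy s').
have DH : D <= e ^+ 2 * cond_entropy mu scheme.
  rewrite /cond_entropy -sumrN mulr_sumr; apply: ler_sum => s _.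
  rewrite -mulrN mulrCA ler_wpM2l ?(ltW (hsignal s))//.
  exact: disagreement_prob_le (he s).
(* A positive [D] is not an empty sum, so there is at least one signal. *)
have S1 : 1 <= Num.sqrt (#|S|%:R : R).
  rewrite -[leLHS]sqrtr1 ler_wsqrtr// ler1n lt0n; apply/eqP => /card0_eq S0.
  by move: D0; rewrite /D big_pred0 ?ltxx// => s; have := S0 s.
apply: (@le_trans _ _ (e * Num.sqrt (cond_entropy mu scheme))).
  (* The chain is [D = sqrt (D ^+ 2) <= sqrt D <= sqrt (e ^+ 2 * H)], with [H] the conditional
     entropy. *)
  rewrite -[e in leRHS](ger0_norm e0) -sqrtr_sqr -sqrtrM ?sqr_ge0//.
  apply: le_trans (ler_wsqrtr DH).
  rewrite -[leLHS](ger0_norm (ltW D0)) -sqrtr_sqr ler_wsqrtr//.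
  by rewrite expr2 ler_piMl// ltW.
by rewrite ler_wpM2r ?sqrtr_ge0// ler_peMr.
Qed.
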